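(* Let $k\ge1$ be an integer and let $D_n$ be the Toeplitz determinants associated with $M_k=[(z-w)^k]$. Then \[ D_n=\prod_{r=0}^{n-1}\frac{r!\,(2k+r)!}{(k+r)!^2},\qquad n\ge1. \] Moreover, the consecutive determinants satisfy \[ \frac{D_{n+1}}{D_n}=\frac{n!\,(n+2k)!}{(n+k)!^2}=\frac{\binom{n+2k}{k}}{\binom{n+k}{k}},\qquad n\ge0. \] In particular, \[ \det A^n=D_{n+1}=\prod_{r=0}^{n}\frac{r!\,(2k+r)!}{(k+r)!^2}. \]
   Context: $H^2(\mathbb D^2)$ is the Hardy space over the bidisk, in which the monomials $z^aw^b$ ($a,b\ge0$) form an orthonormal basis. Let $p_k=(z-w)^k$. For $n\ge0$, $A^n$ is the $(n+1)\times(n+1)$ Gram matrix $A^n=\left(\langle p_kz^iw^{n-i},p_kz^jw^{n-j}\rangle\right)_{i,j=0}^n$; equivalently, its $(i,j)$ entry is $(-1)^{|i-j|}\binom{2k}{k-|i-j|}$ if $|i-j|\le k$ and $0$ otherwise. Put $D_0=1$ and $D_n=\det A^{n-1}$ for $n\ge1$. *)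

(* Defs.v *)
From mathcomp Require Import all_boot all_order all_algebra complex.
From mathcomp Require Import all_classical all_reals all_analysis.

Set Implicit Arguments.
Unset Strict Implicit.
Unset Printing Implicit Defensive.

Import Order.TTheory GRing.Theory Num.Theory.
Import numFieldNormedType.Exports.

Local Open Scope classical_set_scope.
Local Open Scope ring_scope.

(* An element \sum_(a, b) c_(a, b) z^a w^b of H^2(D^2) is represented by its
   square-summable family of Taylor coefficients at the origin. *)
Definition square_summable (R : realType) (c : nat -> nat -> R[i]) : Prop :=
  exists M : R[i],
    forall N : nat, \sum_(a < N) \sum_(b < N) `|c a b| ^+ 2 <= M.

Record hardyD2 (R : realType) := HardyD2 {
  taylor :> nat -> nat -> R[i];
  taylor_square_summable : square_summable taylor }.

(* The double series is absolutely convergent by Cauchy-Schwarz, so it can be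
   summed along squares. The alias R[i]^o carries the topology of R[i]. *)
Definition hardy_dot (R : realType) (f g : hardyD2 R) : R[i] :=
  limn (fun N : nat =>
    (\sum_(a < N) \sum_(b < N) f a b * (g a b)^* : R[i]^o)).

(* C[z, w] is {poly {poly R[i]}}: the outer indeterminate is z, the inner one
   is w, so that P`_a`_b is the coefficient of z^a w^b in P. *)
Definition polyz (R : realType) : {poly {poly R[i]}} := 'X.
Definition polyw (R : realType) : {poly {poly R[i]}} := 'X%:P.

Lemma sumr_le_support (F : numDomainType) (c : nat -> F) (m N : nat) :
  (forall i, 0 <= c i) -> (forall i, (m <= i)%N -> c i = 0) ->
  \sum_(i < N) c i <= \sum_(i < m) c i.
Proof.
move=> c_ge0 c0.
rewrite -!(big_mkord xpredT c); case: (leqP N m) => [leNm | /ltnW lemN].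
  by rewrite (big_cat_nat (leq0n N) leNm) //= lerDl sumr_ge0.
rewrite (big_cat_nat (leq0n m) lemN) /=.
have -> : \sum_(m <= i < N) c i = 0.
  by rewrite big_nat big1 // => i /andP[/c0].
by rewrite addr0.
Qed.

Lemma poly_square_summable (R : realType) (P : {poly {poly R[i]}}) :
  square_summable (fun a b => P`_a`_b).
Proof.
exists (\sum_(a < size P) \sum_(b < size P`_a) `|P`_a`_b| ^+ 2) => N.
pose s a : R[i] := \sum_(b < size P`_a) `|P`_a`_b| ^+ 2.
apply: (@le_trans _ _ (\sum_(a < N) s a)).
  apply: ler_sum => a _.
  apply: (@sumr_le_support _ (fun b => `|P`_a`_b| ^+ 2)) => b.
    by rewrite exprn_ge0.
  by move=> /(nth_default 0) ->; rewrite normr0 expr0n.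
apply: (@sumr_le_support _ s) => a.
  by apply: sumr_ge0 => b _; rewrite exprn_ge0.
move=> /(nth_default 0) Pa0; rewrite /s Pa0 big1 // => b _.
by rewrite coef0 normr0 expr0n.
Qed.

Definition hardy_of_poly (R : realType) (P : {poly {poly R[i]}}) : hardyD2 R :=
  HardyD2 (poly_square_summable P).

Lemma hardy_dot_monomials (R : realType) (a b c d : nat) :
  hardy_dot (hardy_of_poly (polyz R ^+ a * polyw R ^+ b))
            (hardy_of_poly (polyz R ^+ c * polyw R ^+ d))
  = ((a == c) && (b == d))%:R.
Proof.
have coefE i j k l :
    (polyz R ^+ i * polyw R ^+ j)`_k`_l = ((k == i) && (l == j))%:R.
  rewrite /polyz /polyw -rmorphXn /= coefMC coefXn.
  by case: (k == i); rewrite ?mul1r ?mul0r ?coefXn ?coef0.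
apply: (@lim_near_cst R[i]^o); first exact: norm_hausdorff.
exists (maxn a b).+1 => // N /=; rewrite gtn_max => /andP[aN bN].
rewrite (bigD1 (Ordinal aN)) //= (bigD1 (Ordinal bN)) //= !coefE !eqxx mul1r.
rewrite conjC_nat !big1 ?addr0 //.
- move=> i /eqP ia; rewrite big1 // => j _; rewrite coefE.
  case: eqP => [ia'|_]; last by rewrite mul0r.
  by case: ia; apply: val_inj.
- move=> j /eqP jb; rewrite coefE eqxx.
  case: eqP => [jb'|_]; last by rewrite mul0r.
  by case: jb; apply: val_inj.
Qed.

Definition diff_pow (R : realType) (k : nat) : {poly {poly R[i]}} :=
  (polyz R - polyw R) ^+ k.

Definition gram_mx (R : realType) (k n : nat) : 'M[R[i]]_n.+1 :=
  \matrix_(i < n.+1, j < n.+1)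
    hardy_dot (hardy_of_poly (diff_pow R k * polyz R ^+ i * polyw R ^+ (n - i)))
              (hardy_of_poly (diff_pow R k * polyz R ^+ j * polyw R ^+ (n - j))).

Definition toeplitz_det (R : realType) (k n : nat) : R[i] :=
  if n is m.+1 then \det (gram_mx R k m) else 1.

(* Main.v *)
(** Writing G for the Gram matrix, (-1)^(i+j) G_ij is the entry of T T^t, where
    T_ia = 'C(k, a - i) lists the coefficients of the i-th shift of (z+w)^k.
    By Vandermonde's convolution, multiplying on the left by the unitriangular
    Pascal matrix turns T T^t into the matrix
      'C(2k+i, k+j) = ((2k+i)! / (k+i)!) 'C(k+i, j) (j! / (k+j)!),
    and the matrix 'C(k+i, j) has determinant 1, being by the same convolution
    the Pascal matrix times an upper unitriangular matrix. *)

Require Import Defs.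
From mathcomp Require Import all_boot all_order all_algebra complex.
From mathcomp Require Import all_classical all_reals all_analysis.
From mathcomp Require Import zify ring.

Import Order.TTheory GRing.Theory Num.Theory.

Local Open Scope ring_scope.

(* The guard [i <= a] discards the junk value of the truncated [a - i]. *)
Definition band_bin (k i a : nat) : nat := (i <= a)%N * 'C(k, a - i).

(** This is the symmetry of the binomial coefficients. Where the guard of one side fails, the
    binomial of the other side has its lower index above [k], so both sides vanish together. *)
Lemma band_bin_sym (k i a : nat) : band_bin k i a = band_bin k a (k + i).
Proof.
rewrite /band_bin; case: (leqP i a) => ia; case: (leqP a (k + i)) => aki.
- by rewrite !mul1n -bin_sub; [congr binomial|]; lia.
- by rewrite bin_small //; lia.
- by rewrite [in RHS]bin_small //; lia.
- by [].
Qed.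

(** Vandermonde's sum runs over [i <= a]. Any cut-off [N] past [m] or past [a] gives the same value,
    since ['C(m, i)] vanishes for [i > m] and [band_bin k i a] for [i > a]. *)
Lemma Vandermonde_band (N k m a : nat) : (m < N)%N || (a < N)%N ->
  (\sum_(i < N) 'C(m, i) * band_bin k i a)%N = 'C(m + k, a).
Proof.
move=> maN; rewrite -binomial.Vandermonde.
have widen (F : nat -> nat) p q : (p <= q)%N ->
    (forall i, (p <= i)%N -> F i = 0%N) ->
    (\sum_(i < q) F i = \sum_(i < p) F i)%N.
  move=> pq F0; rewrite -!(big_mkord xpredT F) (big_cat_nat (leq0n p) pq) /=.
  rewrite [X in (_ + X)%N]big_nat [X in (_ + X)%N]big1 ?addn0 //.
  by move=> i /andP[/F0].
pose F i := ('C(m, i) * band_bin k i a)%N.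
transitivity (\sum_(i < a.+1) F i)%N; last first.
  by apply: eq_bigr => i _; rewrite /F /band_bin -ltnS ltn_ord mul1n.
case: (leqP N a) => aN.
  apply/esym/(widen F) => [|i Ni]; first by lia.
  by rewrite /F bin_small ?mul0n //; lia.
apply: (widen F) => // i ai.
by rewrite /F /band_bin leqNgt ai muln0.
Qed.

Lemma det_scale (F : comNzRingType) (n : nat) (x y : 'I_n -> F) (A : 'M[F]_n) :
  \det (\matrix_(i, j) (x i * A i j * y j)) =
    (\prod_i x i) * \det A * \prod_i y i.
Proof.
transitivity (\det (diag_mx (\row_i x i) *m A *m diag_mx (\row_i y i))).
  by congr determinant; apply/matrixP=> i j;
    rewrite mul_mx_diag mul_diag_mx !mxE.
by rewrite !det_mulmx !det_diag; congr (_ * _ * _);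
  apply: eq_bigr => i _; rewrite mxE.
Qed.

Lemma det_pascal (F : comNzRingType) (n : nat) :
  \det (\matrix_(i < n, j < n) 'C(i, j)%:R : 'M[F]_n) = 1.
Proof.
rewrite det_trig; first by rewrite big1 // => i _; rewrite mxE binn.
by apply/is_trig_mxP => i j ij; rewrite mxE bin_small.
Qed.

Lemma det_band_bin (F : comNzRingType) (n k : nat) :
  \det (\matrix_(i < n, j < n) (band_bin k i j)%:R : 'M[F]_n) = 1.
Proof.
rewrite -det_tr det_trig.
  by rewrite big1 // => i _; rewrite !mxE /band_bin leqnn subnn bin0.
by apply/is_trig_mxP => i j ij; rewrite !mxE /band_bin leqNgt ij.
Qed.

Lemma det_bin_addl (F : comNzRingType) (n k : nat) :
  \det (\matrix_(i < n, j < n) 'C(i + k, j)%:R : 'M[F]_n) = 1.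
Proof.
transitivity (\det ((\matrix_(i < n, j < n) 'C(i, j)%:R : 'M[F]_n) *m
    \matrix_(i < n, j < n) (band_bin k i j)%:R)); last first.
  by rewrite det_mulmx det_pascal det_band_bin mulr1.
congr determinant; apply/matrixP=> i j; rewrite !mxE.
rewrite -(@Vandermonde_band n k i j) ?ltn_ord // natr_sum.
by apply: eq_bigr => l _; rewrite !mxE natrM.
Qed.

(** The two binomials share the complement [i + k - j], so its factorial links their factorial
    formulas. For [j > i + k] both binomials are zero. *)
Lemma bin_shift_fact (k i j : nat) :
  ('C(i + k + k, k + j) * (k + j)`! * (k + i)`! =
   (2 * k + i)`! * j`! * 'C(i + k, j))%N.
Proof.
case: (leqP j (i + k)) => jik; last by rewrite !bin_small //; lia.
have h1 : (k + j <= i + k + k)%N by lia.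
have e1 := bin_fact h1.
have e2 := bin_fact jik.
have -> : (2 * k + i = i + k + k)%N by lia.
rewrite -e1 [(k + i)%N]addnC -e2.
have -> : (i + k + k - (k + j) = i + k - j)%N by lia.
by ring.
Qed.

Lemma det_bin_shift (F : numFieldType) (n k : nat) :
  \det (\matrix_(i < n, j < n) 'C(i + k + k, k + j)%:R : 'M[F]_n) =
    \prod_(0 <= r < n) ((r`! * (2 * k + r)`!)%:R / ((k + r)`! ^ 2)%:R).
Proof.
have fact_neq0 m : m`!%:R != 0 :> F by rewrite pnatr_eq0 -lt0n fact_gt0.
(* Row and column factors read off from [bin_shift_fact]; [x r * y r] is the [r]-th factor of the
   product. *)
pose x (i : 'I_n) : F := (2 * k + i)`!%:R / (k + i)`!%:R.
pose y (j : 'I_n) : F := j`!%:R / (k + j)`!%:R.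
transitivity (\det (\matrix_(i < n, j < n)
    (x i * (\matrix_(i < n, j < n) 'C(i + k, j)%:R : 'M[F]_n) i j * y j))).
  congr determinant; apply/matrixP=> i j; rewrite !mxE /x /y.
  have /(congr1 (fun m => m%:R : F)) := bin_shift_fact k i j.
  rewrite !natrM => e.
  apply: (mulIf (fact_neq0 (k + j)%N)); apply: (mulIf (fact_neq0 (k + i)%N)).
  by rewrite e; field; rewrite !fact_neq0.
rewrite det_scale det_bin_addl mulr1 -big_split /= big_mkord.
apply: eq_bigr => i _; rewrite /x /y !natrM.
by field; rewrite fact_neq0.
Qed.

Lemma det_band_gram (F : numFieldType) (n k : nat) :
  \det (\matrix_(i < n.+1, j < n.+1)
    (\sum_(a < (n + k).+1) band_bin k i a * band_bin k j a)%:R : 'M[F]_n.+1) =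
    \prod_(0 <= r < n.+1) ((r`! * (2 * k + r)`!)%:R / ((k + r)`! ^ 2)%:R).
Proof.
rewrite -det_bin_shift; set A := \matrix_(i, j) _.
rewrite -[LHS]mul1r -[X in X * \det A](det_pascal F n.+1) -det_mulmx.
congr determinant; apply/matrixP=> l j; rewrite !mxE.
under eq_bigr => i _ do rewrite !mxE -natrM big_distrr.
rewrite -natr_sum exchange_big /=; congr (_%:R).
(* Vandermonde unfolds the target twice: first into a sum over [a] of ['C(l + k, a)] times a band
   entry, which [band_bin_sym] turns into [band_bin k j a]; then ['C(l + k, a)] itself into a sum
   over [i]. *)
rewrite [(k + j)%N]addnC -(@Vandermonde_band (n + k).+1); last first.
  by apply/orP; right; move: (ltn_ord j); lia.
apply: eq_bigr => a _; rewrite addnC in a *.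
rewrite [(j + k)%N]addnC -band_bin_sym -(@Vandermonde_band n.+1) ?ltn_ord //.
by rewrite big_distrl; apply: eq_bigr => i _; rewrite mulnA.
Qed.

Lemma coef_monomial (R : realType) (i j a b : nat) :
  (polyz R ^+ i * polyw R ^+ j)`_a`_b = ((a == i) && (b == j))%:R.
Proof.
rewrite /polyz /polyw -rmorphXn /= coefMC coefXn.
by case: (a == i); rewrite ?mul1r ?mul0r ?coefXn ?coef0.
Qed.

(** The polynomial is homogeneous of degree [n + k], and [z^a] comes only from the binomial term
    [c = k + i - a]. The sign has exponent [k + i + a], of the same parity, to avoid truncated
    subtraction. *)
Lemma coef_diff_pow (R : realType) (k n i a b : nat) : (i <= n)%N ->
  (diff_pow R k * polyz R ^+ i * polyw R ^+ (n - i))`_a`_b =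
    (a + b == n + k)%:R * ((-1) ^+ (k + i + a) * (band_bin k i a)%:R).
Proof.
move=> le_in; rewrite /diff_pow exprBn !mulr_suml !coef_sum.
have coef_term c : (((-1) ^+ c * polyz R ^+ (k - c) * polyw R ^+ c) *+ 'C(k, c)
    * polyz R ^+ i * polyw R ^+ (n - i))`_a`_b =
    (-1) ^+ c * ((a == k - c + i) && (b == c + (n - i)))%N%:R *+ 'C(k, c).
  rewrite !mulrnAl !coefMn; congr (_ *+ _).
  rewrite -coef_monomial.
  have -> : (-1) ^+ c * polyz R ^+ (k - c) * polyw R ^+ c * polyz R ^+ i *
      polyw R ^+ (n - i) = (-1) ^+ c *
      (polyz R ^+ (k - c + i) * polyw R ^+ (c + (n - i))).
    by rewrite !exprD; ring.
  by rewrite -signr_odd -[in RHS]signr_odd !mulr_sign;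
    case: (odd c); rewrite ?coefN.
under eq_bigr => c _ do rewrite coef_term.
case: (boolP [&& i <= a, a <= k + i & a + b == n + k]%N) => [/and3P[ia aki ab]|].
  have ck : (k + i - a < k.+1)%N by lia.
  rewrite (bigD1 (Ordinal ck)) //= big1 => [|c /eqP cne]; last first.
    case: eqP => [ac|_]; last by rewrite mulr0 mul0rn.
    by case: cne; apply: val_inj => /=; move: (ltn_ord c); lia.
  rewrite addr0 ab mul1r band_bin_sym /band_bin aki mul1n mulr_natr.
  have -> : (a == k - (k + i - a) + i)%N by lia.
  have -> : (b == k + i - a + (n - i))%N by lia.
  rewrite /= mulr1n mulr_natr -signr_odd -[in RHS]signr_odd.
  by rewrite oddB ?oddD.
(* No term contributes here. On the right, either the degree test fails or [a] lies outside the
   interval from [i] to [k + i], where [band_bin] vanishes. *)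
move=> out; rewrite big1 => [|c _]; last first.
  case: andP => [[/eqP ac /eqP bc]|_]; last by rewrite mulr0 mul0rn.
  by case/negP: out; move: (ltn_ord c); lia.
case: eqP => [ab|_]; last by rewrite mul0r.
suff -> : band_bin k i a = 0%N by rewrite !mulr0.
rewrite /band_bin; case: (leqP i a) => // ia; rewrite mul1n bin_small //.
by apply: contraR out => ?; apply/and3P; split; [| lia | exact/eqP].
Qed.

Lemma gram_mxE (R : realType) (k n : nat) (i j : 'I_n.+1) :
  gram_mx R k n i j = (-1) ^+ i *
    (\sum_(a < (n + k).+1) band_bin k i a * band_bin k j a)%N%:R * (-1) ^+ j.
Proof.
rewrite mxE; apply: (@lim_near_cst R[i]^o); first exact: norm_hausdorff.
(* By homogeneity every nonzero coefficient has both indices at most [n + k], so the partial sums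
   are constant from this rank on. *)
exists (n + k).+1 => // N /= nkN.
pose F a : R[i] := (-1) ^+ i * (band_bin k i a * band_bin k j a)%:R * (-1) ^+ j.
transitivity (\sum_(a < N) if (a < (n + k).+1)%N then F a else 0).
  apply: eq_bigr => a _.
  pose t (i : nat) : R[i] := (-1) ^+ (k + i + a) * (band_bin k i a)%:R.
  transitivity (\sum_(b < N)
      (a + b == n + k)%N%:R * t i * ((a + b == n + k)%N%:R * t j)^*).
    apply: eq_bigr => b _; congr (_ * _^*); apply: coef_diff_pow;
      exact: leq_ord.
  case: ifP => ank; last first.
    by rewrite big1 // => b _; case: eqP => [?|_]; [lia | rewrite !mul0r].
  (* Only [b = n + k - a] survives in the inner sum. *)
  have bN : (n + k - a < N)%N by lia.
  rewrite (bigD1 (Ordinal bN)) //= big1 => [|b /eqP bne]; last first.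
    case: eqP => [ab|_]; last by rewrite !mul0r.
    by case: bne; apply: val_inj => /=; lia.
  rewrite addr0 subnKC // eqxx !mul1r conj_Creal; last first.
    by rewrite rpredM ?rpredX ?rpredN ?rpred1 ?realn.
  rewrite /t /F natrM !exprD !mulrA.
  (* The signs coming from [k] and [a] occur squared; only those of [i] and [j] remain. *)
  transitivity (((-1) ^+ k * (-1) ^+ k) * ((-1) ^+ a * (-1) ^+ a) *
    ((-1) ^+ i * (band_bin k i a)%:R * (band_bin k j a)%:R * (-1) ^+ j) : R[i]).
    by ring.
  by rewrite -!expr2 !sqrr_sign !mul1r.
rewrite -big_mkcond -(big_ord_widen N F nkN).
by rewrite natr_sum mulr_sumr mulr_suml.
Qed.

(** The row signs and the column signs have the same product, whose square is 1, so they do not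
    affect the determinant. *)
Lemma det_gram_mx (R : realType) (k n : nat) :
  \det (gram_mx R k n) =
    \prod_(0 <= r < n.+1) ((r`! * (2 * k + r)`!)%:R / ((k + r)`! ^ 2)%:R).
Proof.
rewrite -det_band_gram.
set B : 'M[R[i]]_n.+1 := \matrix_(i, j) _.
transitivity (\det (\matrix_(i, j)
    ((-1) ^+ (i : nat) * B i j * (-1) ^+ (j : nat)))).
  by congr determinant; apply/matrixP=> i j; rewrite gram_mxE !mxE.
pose sgn (i : 'I_n.+1) : R[i] := (-1) ^+ i.
rewrite (det_scale _ _ sgn sgn).
by rewrite mulrAC -expr2 -prodrXl big1 ?mul1r // => i _; rewrite sqrr_sign.
Qed.

Lemma toeplitz_detE (R : realType) (k n : nat) :
  toeplitz_det R k n =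
    \prod_(0 <= r < n) ((r`! * (2 * k + r)`!)%:R / ((k + r)`! ^ 2)%:R).
Proof. by case: n => [|n]; [rewrite big_geq | exact: det_gram_mx]. Qed.

Theorem theorem3p1 (R : realType) (k : nat) (hk : (1 <= k)%N) :
  [/\ (forall n : nat, (1 <= n)%N ->
         toeplitz_det R k n =
           \prod_(0 <= r < n)
              ((r`! * (2 * k + r)`!)%:R / ((k + r)`! ^ 2)%:R)),
      (forall n : nat,
         toeplitz_det R k n.+1 / toeplitz_det R k n =
           (n`! * (n + 2 * k)`!)%:R / ((n + k)`! ^ 2)%:R
         /\ (n`! * (n + 2 * k)`!)%:R / ((n + k)`! ^ 2)%:R =
           'C(n + 2 * k, k)%:R / 'C(n + k, k)%:R :> R[i])
    & (forall n : nat,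
         \det (gram_mx R k n) = toeplitz_det R k n.+1
         /\ toeplitz_det R k n.+1 =
           \prod_(0 <= r < n.+1)
              ((r`! * (2 * k + r)`!)%:R / ((k + r)`! ^ 2)%:R))].
Proof.
have fact_neq0 m : m`!%:R != 0 :> R[i] by rewrite pnatr_eq0 -lt0n fact_gt0.
split=> n; first by rewrite toeplitz_detE.
  split.
    (* The product formula shows that [D_n] is nonzero, so the quotient is the factor [r = n]. *)
    have Dn_neq0 : toeplitz_det R k n != 0.
      rewrite toeplitz_detE big_mkord; apply/prodf_neq0 => r _.
      by rewrite !natrM !(mulf_neq0, invr_neq0, expf_neq0).
    rewrite toeplitz_detE big_nat_recr //= -toeplitz_detE mulrC mulKf //.
    by rewrite [(2 * k + n)%N]addnC [(k + n)%N]addnC.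
  have /(congr1 (fun m => m%:R : R[i])) := bin_fact (leq_addl (n + k) k).
  have /(congr1 (fun m => m%:R : R[i])) := bin_fact (leq_addl n k).
  rewrite !addnK -addnA addnn -mul2n !natrM => e1 e2.
  have C_neq0 : 'C(n + k, k)%:R != 0 :> R[i].
    by rewrite pnatr_eq0 -lt0n bin_gt0 leq_addl.
  (* After cross-multiplication, [e2] expands [(n + 2k)!] and [e1] only one of the two factors
     [(n + k)!] on the right; the other matches the one produced by [e2]. *)
  apply/eqP; rewrite eqr_div ?mulf_neq0 // -e2 -{2}e1.
  by apply/eqP; ring.
by split=> //; rewrite toeplitz_detE.
Qed.
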